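(* Let $A$ be a finite skew left brace of nilpotent type. If $(A,\circ)$ has an abelian normal Sylow $p$-subgroup for some prime $p$ dividing $|A|$, then $A$ is right $p$-nilpotent.
   Context: A skew left brace is a triple $(A,+,\circ)$, where $(A,+)$ and $(A,\circ)$ are (not necessarily abelian) groups such that $a\circ(b+c)=a\circ b-a+a\circ c$ for all $a,b,c\in A$. It is of nilpotent type if $(A,+)$ is a nilpotent group. Write $\lambda_a(b)=-a+a\circ b$, $a*b=\lambda_a(b)-b$ and $[a,b]_+=a+b-a-b$. For subsets $X,Y\subseteq A$, $X*Y$ is the subgroup of $(A,+)$ generated by all $x*y$ with $x\in X$, $y\in Y$, and $[X,Y]_+$ is the additive subgroup generated by all $[x,y]_+$ with $x\in X$, $y\in Y$. For subsets $X,Y$ of $A$ define $R_0(X,Y)=X$ and, for $n\geq0$, let $R_{n+1}(X,Y)$ be the additive subgroup generated by $R_n(X,Y)*Y$ and $[R_n(X,Y),Y]_+$. For a prime $p$, a finite skew left brace $A$ of nilpotent type is right $p$-nilpotent if there exists $n\geq1$ such that $R_n(A_p,A)=0$, where $A_p$ is the (unique) Sylow $p$-subgroup of $(A,+)$. *)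

(* Defs.v *)
From HB Require Import structures.
From mathcomp Require Import all_boot all_fingroup all_solvable.
Set Implicit Arguments.
Unset Strict Implicit.
Unset Printing Implicit Defensive.
Import GroupScope.

(* The library writes finite groups multiplicatively, so the additive group
   (A, +) of a brace is the group of the finGroupType A, and a + b, - a, 0 are
   written a * b, a^-1, 1.  The product of (A, \circ) is [circ].               *)

HB.mixin Record Group_isSkewLeftBrace A of monoid.Group A := {
  circ : A -> A -> A;
  circ_one : A;
  circ_inv : A -> A;
  circA : associative circ;
  circ1g : left_id circ_one circ;
  circVg : left_inverse circ_one circ_inv circ;
  (* a \circ (b + c) = a \circ b - a + a \circ c *)
  circDr : forall a b c : A, circ a (b * c) = circ a b * a^-1 * circ a c
}.

#[short(type="skewLeftBraceType")]
HB.structure Definition SkewLeftBrace :=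
  { A of monoid.Group A & Group_isSkewLeftBrace A }.

#[short(type="finSkewLeftBraceType")]
HB.structure Definition FinSkewLeftBrace :=
  { A of FinGroup A & Group_isSkewLeftBrace A }.

(* An alias of the carrier, whose group structure is (A, \circ). *)
Definition circ_group (A : Type) : Type := A.

HB.instance Definition _ (A : finSkewLeftBraceType) :=
  Finite.copy (circ_group A) A.
HB.instance Definition _ (A : finSkewLeftBraceType) :=
  Finite_isGroup.Build (circ_group A) (@circA A) (@circ1g A) (@circVg A).

Definition lambda (A : skewLeftBraceType) (a b : A) : A := a^-1 * circ a b.

Definition star (A : skewLeftBraceType) (a b : A) : A := lambda a b * b^-1.

(* [a, b]_+ = a + b - a - b; the library's [~ a, b] is - a - b + a + b. *)
Definition addcomm (A : groupType) (a b : A) : A := a * b * a^-1 * b^-1.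

Section FiniteBraces.
Variable A : finSkewLeftBraceType.
Implicit Types X Y : {set A}.

Definition starg X Y : {set A} := <<[set star x y | x in X, y in Y]>>.

Definition addcommg X Y : {set A} := <<[set addcomm x y | x in X, y in Y]>>.

Fixpoint rseries X Y (n : nat) : {set A} :=
  if n is m.+1 then
    <<starg (rseries X Y m) Y :|: addcommg (rseries X Y m) Y>>
  else X.

Definition nilpotent_type : bool := nilpotent [set: A].

(* Meant for braces of nilpotent type, for which the Sylow p-subgroup S of
   (A, +) is unique. *)
Definition right_p_nilpotent (p : nat) : Prop :=
  forall S : {group A}, p.-Sylow([set: A]) S ->
  exists2 n : nat, 1 <= n & rseries S [set: A] n = 1.

End FiniteBraces.

Arguments nilpotent_type A : clear implicits.
Arguments right_p_nilpotent A p : clear implicits.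

(* Main.v *)
Require Import Defs.
From mathcomp Require Import all_boot all_fingroup all_solvable.
Import GroupScope.

(** In additive notation, write S for the Sylow p-subgroup of (A, +) and T for
    its p-complement, so that (A, +) is the direct product of S and T, and *
    for the operation [star].  The maps lambda_a are
    automorphisms of (A, +), hence preserve both S and T.  In particular S is
    closed under circ, so it is a p-subgroup of (A, circ) and, having the right
    order, coincides with the given normal abelian Sylow subgroup
    ([circ_Sylow_eq]).

    Normality of S in (A, circ) puts S * A inside S ([star_ideal]), while
    S * T lies in T because T is lambda-invariant; so S * T = 0.  Also
    [S, T]_+ = 0, and therefore the second argument of the series R_n(S, A)
    only matters through its S-component ([star_mul_fixed], [addcomm_mul_cent]).

    It remains to see that the series dies inside S.  Since (S, circ) is
    abelian, x circ y = y circ x, which rewrites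
      x * y = (- x + y + x - y) + (y + (- x + lambda_y(x)) - y) :
    the right action x * y is expressed by an additive commutator and by the
    displacement of x under lambda_y ([star_circ_commute]).  Up to conjugation
    by a translation, both are commutators in the group H of permutations of A
    generated by the additive translations by S and the maps lambda_y for y in
    S.  This H is a product of two p-groups, one normalising the other, so it
    is a p-group, hence nilpotent, and R_n(S, A) embeds, via translations, in
    the (n+1)-st term of its lower central series ([rseries_sub_lcn]). *)

Set Implicit Arguments.
Unset Strict Implicit.
Unset Printing Implicit Defensive.

(** * The lambda maps *)

Section Lambda.
Variable A : finSkewLeftBraceType.
Implicit Types (a b c x y s t : A) (pi : nat_pred).

Lemma circg1 a : circ a 1 = a.
Proof.
have := circDr a 1 1; rewrite mulg1 -mulgA -[LHS]mulg1.
by move=> /mulgI/esym/(canRL (mulVKg a)); rewrite mulg1.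
Qed.

Lemma circE a b : circ a b = a * lambda a b.
Proof. by rewrite /lambda mulKVg. Qed.

Lemma lambdaM a : {morph lambda a : b c / b * c}.
Proof. by move=> b c; rewrite /lambda circDr !mulgA. Qed.

Lemma lambdaV a b : lambda a b^-1 = (lambda a b)^-1.
Proof.
apply/eqP; rewrite eq_sym eq_invg_mul -lambdaM mulgV.
by rewrite /lambda circg1 mulVg.
Qed.

Lemma lambda_circ a b x : lambda (circ a b) x = lambda a (lambda b x).
Proof.
by rewrite {3}/lambda lambdaM lambdaV /lambda invMg invgK !mulgA mulgK circA.
Qed.

Lemma lambda_inj a : injective (lambda a).
Proof.
move=> b c /mulgI eq_ac.
exact: (@mulgI (circ_group A) (a : circ_group A) b c eq_ac).
Qed.

Lemma lambda_p_elt pi a x : pi.-elt x -> pi.-elt (lambda a x).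
Proof.
have lamM : {in [set: A] &, {morph lambda a : b c / b * c}}.
  by move=> b c _ _; exact: lambdaM.
exact: (morph_p_elt (Morphism lamM) (in_setT x)).
Qed.

(** Rewriting x circ y as y circ x trades the action of x on y for that of y
    on x, which is a commutator in the holomorph of (A, +). *)
Lemma star_circ_commute x y : circ x y = circ y x ->
  star x y = [~ x, y^-1] * (x^-1 * lambda y x) ^ y^-1.
Proof.
rewrite /star {1}/lambda => ->.
by rewrite commgEl !conjgE invgK /lambda !mulgA !(mulgK, mulgKV).
Qed.

Lemma star_mul_fixed x s t : star x t = 1 -> star x (s * t) = star x s.
Proof.
move/eqP; rewrite /star -eq_invg_mul eqg_inv => /eqP lam_t.
by rewrite lambdaM lam_t invMg !mulgA mulgK.
Qed.

Lemma addcomm_mul_cent x s t :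
  commute x t -> addcomm x (s * t) = addcomm x s.
Proof.
move=> cxt; rewrite /addcomm invMg !mulgA; congr (_ * _).
by rewrite -(mulgA _ t) (commuteV (commute_sym cxt)) !mulgA mulgK.
Qed.

End Lambda.

(** * The affine permutations of a brace *)

Section Affine.
Variable A : finSkewLeftBraceType.
Implicit Types (a b x y : A) (S : {group A}).

(** Right translations are used, since they compose in the order in which
    permutations are multiplied. *)
Definition transl a : {perm A} := perm (@mulIg A a).
Definition lambda_perm a : {perm A} := perm (@lambda_inj A a).

(** The inverse makes this a morphism rather than an antimorphism. *)
Definition lambda_rep (a : circ_group A) : {perm A} := (lambda_perm a)^-1.

Lemma translM : {in [set: A] &, {morph transl : a b / a * b}}.
Proof. by move=> a b _ _; apply/permP=> x; rewrite permM !permE mulgA. Qed.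
Canonical transl_morphism := Morphism translM.

Lemma lambda_repM :
  {in [set: circ_group A] &, {morph lambda_rep : a b / a * b}}.
Proof.
move=> a b _ _; rewrite /lambda_rep -invMg; congr (_^-1).
by apply/permP=> x; rewrite permM !permE /= -lambda_circ.
Qed.
Canonical lambda_rep_morphism := Morphism lambda_repM.

Lemma transl_inj : injective transl.
Proof. by move=> a b /permP/(_ 1); rewrite !permE !mul1g. Qed.

Lemma translJ_lambda x y : transl x ^ lambda_perm y = transl (lambda y x).
Proof.
apply/permP=> z; rewrite conjgE !permM [RHS]permE.
rewrite [lambda_perm y _]permE [transl x _]permE lambdaM.
by rewrite -[lambda y _](permE (@lambda_inj A y)) permKV.
Qed.

Lemma transl_displacement x y :
  transl (x^-1 * lambda y x) = [~ transl x, lambda_perm y].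
Proof. by rewrite translM ?inE // morphV ?inE // commgEl translJ_lambda. Qed.

Definition affine_group S (P : {group circ_group A}) : {group {perm A}} :=
  (transl @* S <*> lambda_rep @* P)%G.

Lemma transl_affine S (P : {group circ_group A}) x :
  x \in S -> transl x \in affine_group S P.
Proof.
by move=> Sx; apply: subsetP (joing_subl _ _) _ _; rewrite mem_morphim ?inE.
Qed.

Lemma lambda_affine S (P : {group circ_group A}) y :
  y \in P -> lambda_perm y \in affine_group S P.
Proof.
move=> Py; rewrite -groupV; apply: subsetP (joing_subr _ _) _ _.
by apply: (@mem_morphim _ _ _ lambda_rep_morphism); rewrite ?inE.
Qed.

(** The lambda maps normalise the translations by a lambda-invariant subgroup,
    so the affine group is the product of two pi-groups. *)
Lemma affine_pgroup (pi : nat_pred) S (P : {group circ_group A}) :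
    (forall a x, x \in S -> lambda a x \in S) ->
  pi.-group S -> pi.-group P -> pi.-group (affine_group S P).
Proof.
move=> lamS piS piP; rewrite /= norm_joinEr ?pgroupM ?morphim_pgroup //.
apply/subsetP=> _ /morphimP[y _ _ ->]; rewrite groupV inE.
apply/subsetP=> _ /imsetP[_ /morphimP[x _ Sx ->] ->].
by rewrite translJ_lambda mem_morphim ?inE ?lamS.
Qed.

End Affine.

(** * A Sylow subgroup that is normal and abelian for circ *)

Section NormalSylow.
Variables (A : finSkewLeftBraceType) (p : nat).
Variables (S : {group A}) (P : {group circ_group A}).
Hypotheses (nilA : nilpotent_type A) (sylS : p.-Sylow([set: A]) S).
Hypothesis sylP : p.-Sylow([set: circ_group A]) P.
Hypothesis nPA : P <| [set: circ_group A].

Lemma Sylow_eq_pcore : S :=: 'O_p([set: A]).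
Proof. exact: nilpotent_Hall_pcore nilA sylS. Qed.

Lemma Sylow_lambda a x : x \in S -> lambda a x \in S.
Proof.
have memS y : (y \in S) = p.-elt y.
  by rewrite (mem_normal_Hall sylS) ?inE // Sylow_eq_pcore pcore_normal.
by rewrite !memS; exact: lambda_p_elt.
Qed.

Lemma pcore_compl_lambda a x :
  x \in 'O_p^'([set: A]) -> lambda a x \in 'O_p^'([set: A]).
Proof.
have memT y : (y \in 'O_p^'([set: A])) = p^'.-elt y.
  by rewrite (mem_normal_Hall (nilpotent_pcore_Hall _ nilA)) ?inE ?pcore_normal.
by rewrite !memT; exact: lambda_p_elt.
Qed.

(** By lambda-invariance S is a p-subgroup for circ as well, hence lies in the
    normal Sylow subgroup P; the orders agree. *)
Lemma circ_Sylow_eq (x : A) : (x \in S) = ((x : circ_group A) \in P).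
Proof.
pose Sc : {set circ_group A} := [set y : circ_group A | (y : A) \in S].
have grpS : group_set Sc.
  apply/group_setP; split=> [|a b]; rewrite !inE.
    suff -> : (1 : circ_group A) = (1 : A) by exact: group1.
    exact: etrans (esym (circg1 _)) (@circ1g A 1).
  by move=> Sa Sb; rewrite [_ * _]circE groupM ?Sylow_lambda.
have cardSc : #|Sc| = #|S|.
  by apply: eq_card => y; rewrite inE.
have pSc : p.-group (Group grpS).
  by rewrite /pgroup cardSc; exact: pHall_pgroup sylS.
have sSP : Sc \subset P.
  by rewrite (sub_normal_Hall sylP nPA (subsetT (Group grpS))).
suff /setP/(_ x): Sc = P by rewrite inE.
apply/eqP; rewrite eqEcard sSP cardSc (card_Hall sylP) (card_Hall sylS).
by rewrite !cardsT leqnn.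
Qed.

(** Normality for circ gives x circ y = y circ x' with x' in S, and S is also
    normal for +. *)
Lemma star_ideal x y : x \in S -> star x y \in S.
Proof.
move=> Sx.
pose x' : A := ((x : circ_group A) ^ (y : circ_group A)).
have Sx' : x' \in S.
  rewrite circ_Sylow_eq memJ_norm -?circ_Sylow_eq //.
  by rewrite (subsetP (normal_norm nPA)) ?inE.
have -> : star x y = x^-1 * lambda y x' ^ y^-1.
  have -> : star x y = x^-1 * circ x y * y^-1 by [].
  have -> : circ x y = circ y x'.
    exact: (@conjgC (circ_group A) x y).
  by rewrite circE conjgE invgK !mulgA.
rewrite groupM ?groupV // memJ_norm ?Sylow_lambda //.
rewrite Sylow_eq_pcore.
by rewrite (subsetP (normal_norm (pcore_normal _ _))) ?inE.
Qed.

Lemma star_pcore_compl x t :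
  x \in S -> t \in 'O_p^'([set: A]) -> star x t = 1.
Proof.
move=> Sx Tt.
suff: star x t \in 'O_p([set: A]) :&: 'O_p^'([set: A]).
  by rewrite coprime_TIg ?coprime_pcoreC // => /set1P.
rewrite inE -Sylow_eq_pcore star_ideal //=.
by rewrite groupM ?groupV ?pcore_compl_lambda.
Qed.

Lemma Sylow_decomposition y :
  exists s t, [/\ s \in S, t \in 'O_p^'([set: A]) & y = s * t].
Proof.
have /dprodP[_ /setP/(_ y)] := nilpotent_pcoreC p nilA.
rewrite inE => /mulsgP[s t Ss Tt ->] _ _.
by exists s, t; rewrite Sylow_eq_pcore.
Qed.

Lemma Sylow_commute_compl x t :
  x \in S -> t \in 'O_p^'([set: A]) -> commute x t.
Proof.
have /dprodP[_ _ /centsP cTS _] := nilpotent_pcoreC p nilA.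
by rewrite Sylow_eq_pcore => Sx Tt; apply/commute_sym/cTS.
Qed.

(** Both kinds of generators of the next R_n are translated into commutators
    with elements of the affine group, after the second argument has been
    replaced by its component in S. *)
Lemma rseries_sub_lcn n : abelian P ->
  rseries S [set: A] n
    \subset S :&: @transl A @*^-1 'L_n.+1(affine_group S P).
Proof.
move=> abP; set H := affine_group S P; elim: n => [|n IHn].
  by rewrite lcn1; apply/subsetP=> x Sx; rewrite !inE Sx /= transl_affine.
rewrite /= gen_subG subUset !gen_subG.
have nLH : H \subset 'N('L_n.+2(H)) by exact: normal_norm (lcn_normal _ _).
have commL u v : u \in 'L_n.+1(H) -> v \in H -> [~ u, v] \in 'L_n.+2(H).
  by move=> Lu Hv; rewrite lcnSn mem_commg.
apply/andP; split; apply/subsetP=> _ /imset2P[x y /(subsetP IHn) Rx _ ->].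
all: move: Rx; rewrite !inE => /andP[Sx /= Lx].
all: have [s [t [Ss Tt ->]]] := Sylow_decomposition y.
- rewrite star_mul_fixed; last exact: star_pcore_compl.
  rewrite star_ideal //=.
  have Hs := transl_affine P Ss.
  have cxs : circ x s = circ s x.
    by apply: (centsP abP); rewrite -circ_Sylow_eq.
  rewrite star_circ_commute // translM ?inE // morphR ?inE // morphJ ?inE //.
  rewrite /= transl_displacement morphV ?inE //=.
  rewrite groupM ?commL ?groupV // memJ_norm ?(subsetP nLH) ?groupV //.
  by rewrite commL ?lambda_affine // -circ_Sylow_eq.
- rewrite addcomm_mul_cent; last exact: Sylow_commute_compl.
  have -> : addcomm x s = [~ x^-1, s^-1].
    by rewrite /addcomm commgEl conjgE !invgK !mulgA.
  rewrite groupR ?groupV //= morphR ?inE // !morphV ?inE //.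
  by rewrite commL ?groupV ?transl_affine.
Qed.

End NormalSylow.

Theorem theorem5p8 (A : finSkewLeftBraceType) (p : nat)
    (hA : nilpotent_type A) (hp : prime p) (hdvd : p %| #|A|)
    (hSylow : exists P : {group circ_group A},
       [/\ p.-Sylow([set: circ_group A]) P, abelian P
         & P <| [set: circ_group A]]) :
  right_p_nilpotent A p.
Proof.
move=> S sylS; case: hSylow => P [sylP abP nPA].
have nilH : nilpotent (affine_group S P).
  apply: (@pgroup_nil _ p); apply: affine_pgroup (pHall_pgroup sylS) _.
    exact: Sylow_lambda hA sylS.
  exact: pHall_pgroup sylP.
exists (nil_class (affine_group S P)).+1 => //.
set n := _.+1.
have L1 : 'L_n.+1(affine_group S P) = 1 by apply/(lcn_nil_classP _ nilH).
have subR := rseries_sub_lcn hA sylS sylP nPA n abP.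
apply/eqP; rewrite eqEsubset; apply/andP; split.
  apply: subset_trans subR _; apply/subsetP=> x; rewrite L1 !inE.
  case/andP=> _ /eqP tx1; apply/eqP/transl_inj.
  by rewrite tx1 morph1.
by rewrite sub1set /= group1.
Qed.
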